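(* Let $r\ge 2$ be an integer, $n\ge 3r^2$, and $0\le\delta\le 10^{-7}r^{-12}$. If $G$ is an $n$-vertex graph containing no copy of $K_{r+1}$ such that $\lambda(G)\ge\left(1-\frac1r-\delta\right)n$, then $$D_r(G)\le\left(\frac{2r}{3\sqrt3}+o_\delta(1)\right)\delta^{3/2}n^2,$$ where $o_\delta(1)$ denotes a term (depending on $r$ and $\delta$ only) that tends to $0$ as $\delta\to0$.
   Context: $\lambda(G)$ is the spectral radius (largest eigenvalue) of the adjacency matrix of $G$. $K_{r+1}$ is the complete graph on $r+1$ vertices. For a graph $G$, $D_r(G)$ is the minimum number of edges that must be removed from $G$ to make it $r$-partite (i.e. $r$-colorable). *)

(* Defs.v *)
From HB Require Import structures.
From mathcomp Require Import all_boot all_order all_algebra.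
From mathcomp Require Import all_classical all_reals all_analysis.
Set Implicit Arguments. Unset Strict Implicit. Unset Printing Implicit Defensive.
Import Order.TTheory GRing.Theory Num.Theory.
Local Open Scope ring_scope.

Definition simple_graph (n : nat) (e : rel 'I_n) : Prop :=
  symmetric e /\ irreflexive e.

Definition adjmx (R : realType) (n : nat) (e : rel 'I_n) : 'M[R]_n :=
  \matrix_(i, j) (e i j)%:R.

(* Spectral radius lambda(G): the largest eigenvalue of the adjacency matrix,
   i.e. the supremum of its (finite, nonempty) set of real eigenvalues. *)
Definition spec_rad (R : realType) (n : nat) (e : rel 'I_n) : R :=
  sup [set mu : R | eigenvalue (adjmx R e) mu].

Definition has_clique (n k : nat) (e : rel 'I_n) : Prop :=
  exists f : 'I_k -> 'I_n, injective f /\ forall i j, i != j -> e (f i) (f j).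

Definition edges (n : nat) (e : rel 'I_n) : {set 'I_n * 'I_n} :=
  [set p : 'I_n * 'I_n | (p.1 < p.2)%N && e p.1 p.2].

Definition rpartite_after_removal (n r : nat) (e : rel 'I_n)
    (F : {set 'I_n * 'I_n}) : bool :=
  [exists c : {ffun 'I_n -> 'I_r},
     [forall p in edges e, (p \notin F) ==> (c p.1 != c p.2)]].

(* D_r(G): minimum number of edges to remove from G to make it r-partite.
   (Default value #|edges e| is attained by F = all edges when r >= 1.) *)
Definition Dr (n r : nat) (e : rel 'I_n) : nat :=
  \big[minn/#|edges e|]_(F : {set 'I_n * 'I_n} |
        (F \subset edges e) && rpartite_after_removal r e F) #|F|.

(* Main.v *)
(* An eigenvalue [mu] of a [K_(r+1)]-free graph satisfies [mu^2 <= (1 - 1/r) 2e(G)]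
   (Motzkin-Straus), so the hypothesis gives [e(G) >= (1 - 1/r) n^2/2 - delta n^2].
   By Furedi's argument some [r]-colouring then has at most [delta n^2]
   monochromatic edges; fix one with the minimum number [D] of them. Counting
   edges, the classes have size about [n/r] and at most [delta n^2 + D] bichromatic
   pairs are lacking. Every monochromatic edge meets the set of [O(delta n)] vertices
   lacking linearly many pairs. Let [x] be such a vertex with [d] neighbours of its
   own colour. By minimality [x] has at least [d] neighbours of every colour, and its
   neighbourhood is [K_r]-free, which forces [d^2] lacking pairs inside it; moreover
   the smallest colour class [a] of the neighbourhood satisfies [d a = O(delta n^2)], so
   [x] itself lacks almost [n/r] pairs. With [m] such vertices and [d] maximal this
   gives [d^2 + m n/r <= delta n^2 (1 + o(1))] while [D <= m d + o(delta^(3/2)) n^2],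
   and optimizing over [d] yields the constant [2r/(3 sqrt 3)]. *)
Require Import Defs.
From HB Require Import structures.
From mathcomp Require Import all_boot all_order all_algebra.
From mathcomp Require Import ring lra zify.
Set Implicit Arguments. Unset Strict Implicit. Unset Printing Implicit Defensive.
Import Order.TTheory GRing.Theory Num.Theory.
Local Open Scope ring_scope.

Lemma eq_ler (R : numDomainType) (x y : R) : x = y -> x <= y.
Proof. by move=> ->. Qed.

(** * Furedi's degree argument with vertex weights *)

(** Induction on [r]: the neighbourhood of a vertex of maximum weighted degree has smaller cliques
    and is coloured first, then the rest of [U] gets one new colour. The inequality compares all
    edges, monochromatic ones counted twice, with the bichromatic pairs. *)
Lemma furedi_weighted (R : realFieldType) (T : finType) (e : rel T)
    (w : T -> R) (r : nat) (U : {set T}) :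
  symmetric e -> (forall x, 0 <= w x) ->
  (forall s : seq T, all [in U] s -> pairwise e s -> (size s <= r)%N) ->
  exists c : T -> nat, (forall x, x \in U -> (c x < r)%N) /\
    \sum_(x in U) \sum_(y in U) w x * w y *
      ((e x y)%:R * (1 + (c x == c y)%:R) - (c x != c y)%:R) <= 0.
Proof.
move=> sym_e w0; elim: r U => [|r IHr] U Ufree.
  have U0 x : x \in U = false.
    by apply/negP => xU; have := Ufree [:: x]; rewrite /= xU => /(_ isT isT).
  exists (fun=> 0%N); split=> [x|]; first by rewrite U0.
  by rewrite big1 // => x; rewrite U0.
have [->|[x0 x0U]] := set_0Vmem U.
  by exists (fun=> 0%N); split=> [x|]; rewrite ?inE // big_set0.
pose d x : R := \sum_(y in U) w y * (e x y)%:R.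
have [x1 x1U dmax] := arg_maxP d x0U.
pose N := [set y in U | e x1 y].
have NU x : x \in N -> x \in U by rewrite inE => /andP[].
have [|c [cN IHc]] := IHr N.
  move=> s sN sP; rewrite -ltnS; apply: (Ufree (x1 :: s)) => /=.
    by apply/andP; split; [exact: x1U | apply: sub_all sN => y; exact: NU].
  by rewrite sP andbT; apply: sub_all sN => y; rewrite inE => /andP[].
pose c' x := if x \in N then c x else r.
exists c'; split=> [x xU|].
  rewrite /c'; case: ifP => [/cN h|_]; [exact: ltnW | exact: ltnSn].
pose K x y := w x * w y * ((e x y)%:R * (1 + (c' x == c' y)%:R) - (c' x != c' y)%:R).
rewrite -/(\sum_(x in U) \sum_(y in U) K x y).
have Ksym x y : K x y = K y x by rewrite /K sym_e [c' x == _]eq_sym (mulrC (w x)).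
pose V := U :\: N.
have split_sum (F : T -> R) : \sum_(x in U) F x = \sum_(x in N) F x + \sum_(x in V) F x.
  rewrite (big_setID N) /=; congr (_ + _); apply: eq_bigl => x.
  by rewrite inE andbC; apply/andb_idr; exact: NU.
rewrite split_sum (eq_bigr (fun x => \sum_(y in N) K x y + \sum_(y in V) K x y)); last first.
  by move=> x _; rewrite split_sum.
rewrite [X in _ + X](eq_bigr (fun x => \sum_(y in N) K x y + \sum_(y in V) K x y)); last first.
  by move=> x _; rewrite split_sum.
rewrite !big_split /= [X in _ + X + _]exchange_big /=.
rewrite [X in _ + X + _](eq_bigr (fun x => \sum_(y in N) K x y)); last first.
  by move=> x _; apply: eq_bigr => y _; exact: Ksym.
have -> : \sum_(x in N) \sum_(y in N) K x y = \sum_(x in N) \sum_(y in N) w x * w y *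
      ((e x y)%:R * (1 + (c x == c y)%:R) - (c x != c y)%:R).
  by apply: eq_bigr => x xN; apply: eq_bigr => y yN; rewrite /K /c' xN yN.
set A := \sum_(x in N) _ in IHc *.
pose W := \sum_(y in N) w y.
have dx1 : d x1 = W.
  rewrite /d /W split_sum [X in _ + X]big1 ?addr0.
    by apply: eq_bigr => y; rewrite inE => /andP[_ ->]; rewrite mulr1.
  by move=> y; rewrite !inE => /andP[]; case: (y \in U) => //= /negbTE ->; rewrite mulr0.
have rVN x : x \in V -> \sum_(y in N) K x y = w x * (\sum_(y in N) w y * (e x y)%:R - W).
  move=> xV; rewrite /W -sumrB big_distrr /=; apply: eq_bigr => y yN.
  rewrite /K /c' yN; move: xV; rewrite inE => /andP[/negbTE -> _].
  have -> /= : r == c y = false by apply/negbTE; rewrite neq_ltn cN ?orbT.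
  by ring.
have rVV x : x \in V -> \sum_(y in V) K x y = 2 * (w x * \sum_(y in V) w y * (e x y)%:R).
  move=> xV; rewrite !big_distrr /=; apply: eq_bigr => y yV.
  rewrite /K /c'; move: xV yV; rewrite !inE => /andP[/negbTE -> _] /andP[/negbTE -> _].
  by rewrite eqxx /=; ring.
rewrite (eq_bigr _ rVN) (eq_bigr _ rVV).
set B := \sum_(i in V) w i * (_ - _); set C := \sum_(i in V) 2 * _.
(* [A] is the inductive part; the cross pairs [B] occur in both orders, and [C] lies inside the new
   class. Each [x] in [V] contributes twice [w x] times its weighted degree minus [W], the maximum
   degree. *)
suff : B + B + C <= 0 by rewrite /B /C in IHc *; lra.
rewrite /B /C -!big_split /=; apply: sumr_le0 => x xV.
have xU : x \in U by move: xV; rewrite inE => /andP[].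
have := dmax x xU; rewrite dx1 /d split_sum => dx.
have := w0 x; move: dx; set a := \sum_(y in N) _; set b := \sum_(y in V) _; move=> dx wx.
have := mulr_ge0 wx (_ : 0 <= W - (a + b)); rewrite subr_ge0 => /(_ dx); lra.
Qed.

Lemma sum_class (R : realFieldType) (T I : finType) (c : T -> I) (F : T -> R) :
  \sum_x F x = \sum_i \sum_(x | c x == i) F x.
Proof. by rewrite (partition_big c xpredT). Qed.

Lemma sum_same_class (R : realFieldType) (T I : finType) (c : T -> I) (w : T -> R) :
  \sum_x \sum_y w x * w y * (c x == c y)%:R = \sum_i (\sum_(x | c x == i) w x) ^+ 2.
Proof.
rewrite (sum_class c); apply: eq_bigr => i _.
rewrite expr2 big_distrl /=; apply: eq_bigr => x /eqP cx.
rewrite big_distrr /= [RHS]big_mkcond; apply: eq_bigr => y _.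
by rewrite cx eq_sym; case: eqP; rewrite ?mulr1 ?mulr0.
Qed.

(** The variance identity. Its nonnegativity bounds the monochromatic weight from below; later it
    measures how far the classes are from balanced. *)
Lemma sum_sqr_dev (R : realFieldType) (r : nat) (W : 'I_r -> R) :
  (0 < r)%N ->
  \sum_i (W i - (\sum_i W i) / r%:R) ^+ 2 = \sum_i W i ^+ 2 - (\sum_i W i) ^+ 2 / r%:R.
Proof.
move=> r0; set S := \sum_i W i.
rewrite (eq_bigr (fun i => W i ^+ 2 - (2 * S / r%:R) * W i + (S / r%:R) ^+ 2)); last first.
  by move=> i _; ring.
rewrite !big_split /= sumr_const card_ord sumrN -big_distrr /= -/S -mulr_natl.
have : r%:R != 0 :> R by rewrite pnatr_eq0 -lt0n.
by move=> ?; field.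
Qed.

(** By convexity the monochromatic pairs of [r] classes carry at least [1 / r] of the total weight,
    and the bichromatic pairs, which bound the left side, carry the rest. Unit weights serve
    stability, squared eigenvector entries the spectral bound. *)
Lemma furedi_coloring (R : realFieldType) (T : finType) (e : rel T)
    (w : T -> R) (r : nat) :
  (0 < r)%N -> symmetric e -> (forall x, 0 <= w x) ->
  (forall s : seq T, pairwise e s -> (size s <= r)%N) ->
  exists c : T -> 'I_r,
    \sum_x \sum_y w x * w y * (e x y)%:R +
    \sum_x \sum_y w x * w y * (e x y && (c x == c y))%:R
      <= (1 - r%:R^-1) * (\sum_x w x) ^+ 2.
Proof.
case: r => // r _ sym_e w0 efree.
have [|c [cr cP]] := @furedi_weighted _ _ _ w r.+1 setT sym_e w0.
  by move=> s _; exact: efree.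
pose c' x := inord (c x) : 'I_r.+1.
have cc' x y : (c' x == c' y) = (c x == c y).
  by rewrite -val_eqE /= !inordK ?cr ?inE.
exists c'.
have := sum_sqr_dev (fun i => \sum_(x | c' x == i) w x) isT.
rewrite -sum_class -sum_same_class => dev.
have dev0 : 0 <= \sum_x \sum_y w x * w y * (c' x == c' y)%:R - (\sum_x w x) ^+ 2 / r.+1%:R.
  by rewrite -dev; apply: sumr_ge0 => i _; exact: sqr_ge0.
have tot : (\sum_x w x) ^+ 2 = \sum_x \sum_y w x * w y.
  by rewrite expr2 big_distrl; apply: eq_bigr => x _; rewrite big_distrr.
rewrite subr_ge0 in dev0; rewrite mulrBl mul1r [_^-1 * _]mulrC.
suff : \sum_x \sum_y w x * w y * (e x y)%:R +
    \sum_x \sum_y w x * w y * (e x y && (c' x == c' y))%:R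
    <= (\sum_x w x) ^+ 2 - \sum_x \sum_y w x * w y * (c' x == c' y)%:R.
  by move=> /le_trans; apply; rewrite lerB.
rewrite -subr_le0 tot; apply: le_trans cP.
have inT (F : T -> R) : \sum_(x in setT) F x = \sum_x F x by apply: eq_bigl => x; rewrite inE.
rewrite inT -!sumrB -big_split -sumrB; apply: ler_sum => x _.
rewrite inT -!sumrB -big_split -sumrB; apply: ler_sum => y _ /=.
rewrite cc'; case: (c x == c y); rewrite ?andbT ?andbF /= ?mulr1n ?mulr0n; lra.
Qed.

(** * Transversal cliques *)

Fixpoint pair_sum (R : realFieldType) (X : Type) (F : X -> X -> R) (s : seq X) : R :=
  if s is x :: s' then \sum_(y <- s') F x y + pair_sum F s' else 0.

Definition avg (R : realFieldType) (T : finType) (B : {set T}) (g : T -> R) : R :=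
  (\sum_(x in B) g x) / #|B|%:R.

Lemma avgD (R : realFieldType) (T : finType) (B : {set T}) (g h : T -> R) :
  avg B (fun x => g x + h x) = avg B g + avg B h.
Proof. by rewrite /avg big_split mulrDl. Qed.

Lemma avg_sum (R : realFieldType) (T : finType) (I : Type) (s : seq I)
    (B : {set T}) (g : I -> T -> R) :
  avg B (fun x => \sum_(i <- s) g i x) = \sum_(i <- s) avg B (g i).
Proof. by rewrite /avg exchange_big big_distrl. Qed.

Lemma exists_le_avg (R : realFieldType) (T : finType) (B : {set T}) (g : T -> R) :
  B != set0 -> exists2 x, x \in B & g x <= avg B g.
Proof.
move=> B0; apply/exists_inP; apply: contraT; rewrite negb_exists_in => /forall_inP gB.
have [x0 x0B] := set0Pn _ B0.
have : \sum_(x in B) avg B g < \sum_(x in B) g x.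
  by apply: ltr_sum => [|x /gB]; [apply/hasP; exists x0; rewrite ?mem_index_enum | rewrite ltNge].
rewrite sumr_const -[_ *+ _]mulr_natr /avg divfK ?ltxx //.
by rewrite pnatr_eq0 cards_eq0.
Qed.

(* Method of conditional expectations: fixing a vertex [v] of the first set
   turns the pairs through [v] into a vertex cost on the remaining sets. *)
Lemma transversal_le_avg (R : realFieldType) (T : finType) (h : T -> T -> R)
    (Bs : seq {set T}) (g : T -> R) :
  all (fun B => B != set0) Bs ->
  exists t : seq T, all2 (fun x (B : {set T}) => x \in B) t Bs /\
    \sum_(x <- t) g x + pair_sum h t <=
    \sum_(B <- Bs) avg B g +
    pair_sum (fun B C => avg B (fun x => avg C (h x))) Bs.
Proof.
elim: Bs g => [|B Bs IH] g /=; first by exists [::]; rewrite !big_nil.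
move=> /andP[B0 Bs0].
have [v vB vle] := exists_le_avg (fun x => g x + \sum_(C <- Bs) avg C (h x)) B0.
have [t [tBs tle]] := IH (fun x => g x + h v x) Bs0.
exists (v :: t); split; first by rewrite /= vB.
rewrite !big_cons /=.
rewrite big_split /= in tle.
rewrite (eq_bigr (fun C => avg C g + avg C (h v))) in tle; last by move=> *; rewrite avgD.
rewrite big_split /= in tle; rewrite avgD avg_sum in vle.
lra.
Qed.

Definition nonadj (T : finType) (e : rel T) (B C : {set T}) : nat :=
  \sum_(x in B) \sum_(y in C) ~~ e x y.

Lemma pair_sum_ge0 (R : realFieldType) (X : Type) (F : X -> X -> R) (s : seq X) :
  (forall x y, 0 <= F x y) -> 0 <= pair_sum F s.
Proof. by move=> F0; elim: s => //= x s IH; apply: addr_ge0 => //; apply: sumr_ge0. Qed.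

Lemma pairwise_pair_sum (R : realFieldType) (T : eqType) (e : rel T) (t : seq T) :
  pair_sum (fun x y => (~~ e x y)%:R : R) t < 1 -> pairwise e t.
Proof.
elim: t => //= x t IH tlt.
have h0 : 0 <= pair_sum (fun x y => (~~ e x y)%:R : R) t by exact: pair_sum_ge0.
have s0 : 0 <= \sum_(y <- t) (~~ e x y)%:R :> R by apply: sumr_ge0.
rewrite IH ?andbT; last by lra.
apply/allP => y yt; apply: contraT => nexy.
have : 1 <= \sum_(y <- t) (~~ e x y)%:R :> R; last by lra.
rewrite (big_rem y) //= nexy lerDl; exact: sumr_ge0.
Qed.

Lemma pair_sum_le (R : realFieldType) (X : eqType) (F G : X -> X -> R) (s : seq X) :
  uniq s -> {in s &, forall x y, x != y -> F x y <= G x y} ->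
  pair_sum F s <= pair_sum G s.
Proof.
elim: s => //= x s IH /andP[xs us] FG; apply: lerD.
  rewrite !big_seq; apply: ler_sum => y ys; apply: FG; rewrite ?inE ?eqxx ?ys ?orbT //.
  by apply: contraNneq xs => ->.
by apply: IH => // y z ys zs; apply: FG; rewrite inE ?ys ?zs orbT.
Qed.

Lemma pair_sum_sym (R : realFieldType) (X : eqType) (F : X -> X -> R) (s : seq X) :
  uniq s -> (forall x y, F x y = F y x) ->
  2 * pair_sum F s = \sum_(x <- s) \sum_(y <- s | y != x) F x y.
Proof.
move=> + Fsym; elim: s => [|x s IH] /=; first by rewrite big_nil mulr0.
move=> /andP[xs us]; rewrite big_cons big_cons eqxx /= mulrDr IH //.
have nx : \sum_(y <- s | y != x) F x y = \sum_(y <- s) F x y.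
  rewrite [LHS]big_seq_cond [RHS]big_seq; apply: eq_bigl => y.
  by case: (boolP (y \in s)) => //= ys; apply: contraNneq xs => <-.
rewrite nx [X in _ = _ + X](_ : _ = \sum_(y <- s) F x y + \sum_(z <- s) \sum_(y <- s | y != z) F z y); first by ring.
rewrite -big_split /= big_seq [RHS]big_seq; apply: eq_bigr => z zs.
by rewrite big_cons Fsym; case: eqP => [xz|]; first by rewrite xz zs in xs.
Qed.

Lemma pair_sum_map (R : realFieldType) (X Y : Type) (f : Y -> X) (F : X -> X -> R) (s : seq Y) :
  pair_sum F (map f s) = pair_sum (fun x y => F (f x) (f y)) s.
Proof. by elim: s => //= x s ->; rewrite big_map. Qed.

Lemma pair_sumM (R : realFieldType) (X : Type) (a : R) (F : X -> X -> R) (s : seq X) :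
  pair_sum (fun x y => F x y * a) s = pair_sum F s * a.
Proof. by elim: s => [|x s /= ->] /=; rewrite ?mul0r // mulrDl big_distrl. Qed.

Lemma avg_nonadj (R : realFieldType) (T : finType) (e : rel T) (B C : {set T}) :
  avg B (fun x => avg C (fun y => (~~ e x y)%:R)) =
  (nonadj e B C)%:R / (#|B| * #|C|)%:R :> R.
Proof.
rewrite /avg -big_distrl /= -mulrA natrM invfM [_ ^-1 / _]mulrC; congr (_ * _).
by rewrite /nonadj raddf_sum; apply: eq_bigr => x _; rewrite raddf_sum.
Qed.

Lemma nonadj_sym (T : finType) (e : rel T) (B C : {set T}) :
  symmetric e -> nonadj e B C = nonadj e C B.
Proof.
move=> sym_e; rewrite /nonadj exchange_big; apply: eq_bigr => x _.
by apply: eq_bigr => y _; rewrite sym_e.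
Qed.

(** In a random transversal the expected number of nonadjacent pairs is the sum of the nonadjacency
    densities. The hypothesis sums over ordered pairs, so staying below [2 * P] makes this
    expectation less than 1. *)
Lemma transversal_clique (T I : finType) (e : rel T) (B : I -> {set T})
    (s : seq I) (P : nat) :
  symmetric e -> uniq s -> (0 < P)%N ->
  {in s, forall i, B i != set0} ->
  {in s &, forall i j, i != j -> (P <= #|B i| * #|B j|)%N} ->
  (\sum_(i <- s) \sum_(j <- s | j != i) nonadj e (B i) (B j) < 2 * P)%N ->
  exists t : seq T, [/\ all2 (fun x i => x \in B i) t s & pairwise e t].
Proof.
move=> sym_e us P0 B0 BP small.
have B0' : all (fun C => C != set0) (map B s) by rewrite all_map; apply/allP => i /B0.
have [t [tB tle]] := transversal_le_avg (R := rat) (fun x y => (~~ e x y)%:R) (fun=> 0) B0'.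
exists t; split.
  by move: tB; elim: (t) (s) => [|x t' IH] [|i s'] //= /andP[-> /IH].
apply: (@pairwise_pair_sum rat).
have P0' : 0 < P%:R :> rat by rewrite ltr0n.
move: tle; rewrite big1 // add0r big1 ?add0r; last first.
  by move=> C _; rewrite /avg big1 ?mul0r.
move=> /le_lt_trans; apply; rewrite pair_sum_map.
apply: (@le_lt_trans _ _ (pair_sum (fun i j => (nonadj e (B i) (B j))%:R / P%:R : rat) s)).
  apply: pair_sum_le => // i j is_ js ij; rewrite avg_nonadj.
  by rewrite ler_wpM2l // lef_pV2 ?posrE ?ler_nat ?ltr0n ?BP // (leq_trans P0) ?BP.
rewrite pair_sumM ltr_pdivrMr // mul1r.
rewrite -(@ltr_pM2l _ 2) // pair_sum_sym //; last by move=> i j; rewrite nonadj_sym.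
move: small; rewrite -(ltr_nat rat) natrM raddf_sum /=.
by under eq_bigr do rewrite raddf_sum.
Qed.

(** * Lacking pairs of a colouring *)

Section Coloring.
Local Open Scope nat_scope.
Variables (T I : finType) (e : rel T).
Hypotheses (sym_e : symmetric e) (irr_e : irreflexive e).
Implicit Types (c : T -> I) (x y : T) (i j : I) (W : {set T}).

Definition color_class c i : {set T} := [set y | c y == i].
Definition nbrs c x i : {set T} := [set y | e x y & c y == i].
(** Ordered pairs are counted, so this is twice the number of monochromatic edges. *)
Definition inner c : nat := \sum_x \sum_y (e x y && (c x == c y)).
Definition lacking c x y : bool := (c x != c y) && ~~ e x y.
Definition lack_deg c x : nat := \sum_y lacking c x y.
(** The removed set [W] allows the lacking pairs at a few exceptional vertices to be counted
    separately. *)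
Definition lack c W : nat := \sum_(x in ~: W) \sum_(y in ~: W) lacking c x y.

Lemma lackingC c x y : lacking c x y = lacking c y x.
Proof. by rewrite /lacking eq_sym sym_e. Qed.

Lemma sum_bool_card (P : pred T) : \sum_y (P y : nat) = #|[set y | P y]|.
Proof.
rewrite -sum1dep_card [RHS]big_mkcond; apply: eq_bigr => y _.
by case: (P y).
Qed.

Lemma inner_split c x :
  inner c = 2 * \sum_(y | y != x) (e x y && (c x == c y)) +
            \sum_(y | y != x) \sum_(z | z != x) (e y z && (c y == c z)).
Proof.
have row y : \sum_z (e y z && (c y == c z)) = (e y x && (c y == c x)) +
    \sum_(z | z != x) (e y z && (c y == c z)) by rewrite (bigD1 x).
rewrite /inner (bigD1 x) //= row irr_e add0n.
under [X in _ + X = _]eq_bigr do rewrite row.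
rewrite big_split /= addnA mul2n -addnn; congr (_ + _ + _).
by apply: eq_bigr => y _; rewrite sym_e [c y == _]eq_sym.
Qed.

Lemma nbrs_sum c x j : #|nbrs c x j| = \sum_(y | y != x) (e x y && (c y == j)).
Proof.
by rewrite -sum_bool_card (bigD1 x) //= irr_e.
Qed.

(** Recolouring [x] with [j] changes only the monochromatic edges at [x]. *)
Lemma inner_min_nbrs (c : {ffun T -> I}) x j :
  (forall c' : {ffun T -> I}, inner c <= inner c') ->
  #|nbrs c x (c x)| <= #|nbrs c x j|.
Proof.
move=> cmin; pose c' : {ffun T -> I} := [ffun y => if y == x then j else c y].
have := cmin c'; rewrite (inner_split c x) (inner_split c' x).
have -> : \sum_(y | y != x) \sum_(z | z != x) (e y z && (c' y == c' z)) =
    \sum_(y | y != x) \sum_(z | z != x) (e y z && (c y == c z)).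
  apply: eq_bigr => y /negbTE yx; apply: eq_bigr => z /negbTE zx.
  by rewrite !ffunE yx zx.
rewrite leq_add2r leq_mul2l /= !nbrs_sum => h.
rewrite (eq_bigr (fun y => (e x y && (c x == c y)) : nat)); last first.
  by move=> y _; rewrite eq_sym.
apply: leq_trans h _; apply: leq_sum => y /negbTE yx.
by rewrite !ffunE eqxx yx eq_sym.
Qed.

(** Each ordered monochromatic pair is charged to an end in [S], which may be its first or its
    second vertex. *)
Lemma inner_cover c (S : {set T}) :
  (forall x y, e x y -> c x = c y -> (x \in S) || (y \in S)) ->
  inner c <= 2 * \sum_(x in S) #|nbrs c x (c x)|.
Proof.
move=> Scov; pose k x y : nat := e x y && (c x == c y).
have kC x y : k x y = k y x by rewrite /k sym_e eq_sym.
have -> : \sum_(x in S) #|nbrs c x (c x)| = \sum_(x in S) \sum_y k x y.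
  apply: eq_bigr => x _; rewrite /k sum_bool_card; apply: eq_card => y.
  by rewrite !inE eq_sym.
rewrite mul2n -addnn {2}exchange_big /= [X in X + _]big_mkcond -big_split /=.
apply: leq_sum => x _; rewrite [X in _ + X]big_mkcond /=.
have -> : (if x \in S then \sum_y k x y else 0) = \sum_y (if x \in S then k x y else 0).
  by case: ifP => // _; rewrite big1.
rewrite -big_split /=; apply: leq_sum => y _.
rewrite [k y x]kC -/(k x y); case: (posnP (k x y)) => [-> //|].
rewrite /k lt0b => /andP[exy /eqP cxy]; rewrite exy cxy eqxx /=.
by have := Scov _ _ exy cxy; case: (x \in S); case: (y \in S).
Qed.

Lemma class_le_lack_nbrs c x i : i != c x ->
  #|color_class c i| <= lack_deg c x + #|nbrs c x i|.
Proof.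
move=> ix; rewrite /lack_deg -!sum_bool_card -big_split; apply: leq_sum => y _ /=.
rewrite /lacking; case: eqP => [->|_] //=; rewrite eq_sym ix andbT /=.
by case: (e x y).
Qed.

Lemma class_le_common c x y i : i != c x -> i != c y ->
  #|color_class c i| <= #|nbrs c x i :&: nbrs c y i| + lack_deg c x + lack_deg c y.
Proof.
move=> ix iy; rewrite /lack_deg -!sum_bool_card.
rewrite -!big_split; apply: leq_sum => z _ /=; rewrite !inE /lacking.
case: (eqVneq (c z) i) => [->|_] //=; rewrite !andbT ![_ == i]eq_sym ix iy /=.
by case: (e x z); case: (e y z).
Qed.

(** The doubled degree sum counts the pairs inside [W] once too often, and there are at most
    [#|W| ^ 2] of them. *)
Lemma lack_split c W :
  lack c W + 2 * \sum_(x in W) lack_deg c x <= lack c set0 + #|W| ^ 2.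
Proof.
have split_sum (F : T -> nat) : \sum_x F x = \sum_(x in W) F x + \sum_(x in ~: W) F x.
  rewrite (bigID (mem W)) /=; congr (_ + _).
  by apply: eq_bigl => x; rewrite inE.
pose X := \sum_(x in W) \sum_(y in W) lacking c x y.
pose Y := \sum_(x in W) \sum_(y in ~: W) lacking c x y.
have -> : lack c set0 = X + Y + (Y + lack c W).
  rewrite /lack setC0 (eq_bigl xpredT); last by move=> x; rewrite inE.
  rewrite (eq_bigr (lack_deg c)); last first.
    by move=> x _; apply: eq_bigl => y; rewrite inE.
  rewrite split_sum; congr (_ + _).
    by rewrite -big_split; apply: eq_bigr => x _; rewrite /lack_deg split_sum.
  rewrite /Y [X in _ = X + _]exchange_big /lack -big_split; apply: eq_bigr => x _ /=.
  rewrite [X in X + _](eq_bigr (fun y => lacking c x y : nat)); last first.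
    by move=> y _; rewrite lackingC.
  by rewrite /lack_deg split_sum.
have -> : \sum_(x in W) lack_deg c x = X + Y.
  by rewrite -big_split; apply: eq_bigr => x _; rewrite /lack_deg split_sum.
suff : X <= #|W| ^ 2 by lia.
rewrite /X -mulnn -sum_nat_const; apply: leq_sum => x _.
by rewrite -sum1_card; apply: leq_sum => y _; case: lacking.
Qed.

Lemma lack_total c : lack c set0 = \sum_x lack_deg c x.
Proof.
rewrite /lack setC0 (eq_bigl xpredT); last by move=> x; rewrite inE.
by apply: eq_bigr => x _; apply: eq_bigl => y; rewrite inE.
Qed.

(** Every ordered pair is an edge, lacking or monochromatic, and only the monochromatic edges are
    counted twice. *)
Lemma lack_edges c :
  \sum_x \sum_y e x y + lack c set0 + \sum_i #|color_class c i| ^ 2 = #|T| ^ 2 + inner c.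
Proof.
have -> : \sum_i #|color_class c i| ^ 2 = \sum_x \sum_y (c x == c y).
  rewrite (partition_big c xpredT) //=; apply: eq_bigr => i _.
  rewrite -mulnn -sum_nat_const; apply: eq_big => [x|x]; rewrite inE // => /eqP <-.
  by rewrite sum_bool_card; apply: eq_card => y; rewrite !inE eq_sym.
have -> : #|T| ^ 2 = \sum_(x : T) \sum_(y : T) 1.
  by rewrite sum_nat_const sum1_card -mulnn.
rewrite lack_total /inner -!big_split; apply: eq_bigr => x _ /=.
rewrite /lack_deg -!big_split; apply: eq_bigr => y _ /=; rewrite /lacking.
by case: (e x y); case: eqP.
Qed.

Lemma nonadj_le_lack c W (B : I -> {set T}) (s : seq I) :
  uniq s -> {in s, forall i, B i \subset color_class c i :\: W} ->
  \sum_(i <- s) \sum_(j <- s | j != i) nonadj e (B i) (B j) <= lack c W.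
Proof.
move=> us sB.
have le_all (P : pred I) (F : I -> nat) : \sum_(i <- s | P i) F i <= \sum_(i | P i) F i.
  rewrite -big_filter big_uniq ?filter_uniq //= [X in _ <= X](bigID [in s]) /=.
  apply: leq_trans (leq_addr _ _).
  rewrite leq_eqVlt; apply/orP; left; apply/eqP.
  by apply: eq_bigl => i; rewrite mem_filter.
have part (F : T -> nat) : \sum_(x in ~: W) F x = \sum_i \sum_(x in color_class c i :\: W) F x.
  rewrite (partition_big c xpredT) //=; apply: eq_bigr => i _.
  by apply: eq_bigl => x; rewrite !inE.
have sub_le (A1 A2 : {set T}) (F : T -> nat) : A1 \subset A2 ->
    \sum_(x in A1) F x <= \sum_(x in A2) F x.
  move=> /setIidPr A12; rewrite [X in _ <= X](big_setID A1) A12 /=; exact: leq_addr.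
rewrite /lack part.
apply: leq_trans (le_all xpredT _); rewrite !big_seq; apply: leq_sum => i si.
apply: (@leq_trans (\sum_(x in B i) \sum_(y in ~: W) lacking c x y)); last first.
  by apply: sub_le; exact: sB.
rewrite /nonadj exchange_big; apply: leq_sum => x xB.
pose G j := \sum_(y in color_class c j :\: W) (lacking c x y : nat).
have -> : \sum_(y in ~: W) lacking c x y = \sum_j G j by exact: part.
apply: (@leq_trans (\sum_(j | j != i) G j)); last first.
  by rewrite [X in _ <= X](bigID (fun j => j != i)) leq_addr.
apply: leq_trans (le_all _ _).
rewrite big_seq_cond [X in _ <= X]big_seq_cond; apply: leq_sum => j /andP[js ji].
apply: leq_trans (sub_le _ _ _ (sB _ js)).
apply: leq_sum => y yB; rewrite /lacking.
have /(subsetP (sB _ js)) := yB; rewrite !inE => /andP[_ /eqP ->].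
by have /(subsetP (sB _ si)) := xB; rewrite !inE => /andP[_ /eqP ->]; rewrite eq_sym ji.
Qed.

(* [lack c W] counts ordered pairs, hence the factor 2. *)
Lemma transversal_free_lack c W (B : I -> {set T}) (s : seq I) (Q : seq T) (r : nat) :
  (forall t : seq T, pairwise e t -> size t <= r) ->
  pairwise e Q -> uniq s -> r < size Q + size s ->
  {in s, forall i, B i \subset color_class c i :\: W} ->
  {in s, forall i, B i != set0} ->
  {in s, forall i, {in Q & B i, forall x y, e x y}} ->
  ~ {in s &, forall i j, i != j -> lack c W < 2 * (#|B i| * #|B j|)}.
Proof.
move=> efree Qe us rsize sB B0 QB Black; pose P := (lack c W)./2.+1.
have BP : {in s &, forall i j, i != j -> P <= #|B i| * #|B j|}.
  by move=> i j si sj ij; rewrite /P; have := Black i j si sj ij; lia.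
have [|t [tB te]] := transversal_clique sym_e us (ltn0Sn _) B0 BP.
  by apply: leq_ltn_trans (nonadj_le_lack us sB) _; rewrite /P; lia.
have st : size t = size s by move: tB; rewrite all2E => /andP[/eqP].
suff /efree : pairwise e (Q ++ t) by rewrite size_cat st leqNgt rsize.
rewrite pairwise_cat Qe te !andbT.
apply/allrelP => x y xQ yt.
have [i si yB] : exists2 i, i \in s & y \in B i.
  move: tB yt; elim: (t) (s) => [|z t' IH] [|j s'] //= /andP[zB /IH{}IH].
  rewrite inE => /predU1P[->|/IH[i is_ yi]]; first by exists j; rewrite ?inE ?eqxx.
  by exists i; rewrite ?inE ?is_ ?orbT.
exact: QB yB.
Qed.

(** * Colourings that recolouring a given vertex does not improve *)

Section LocalOptimum.
Variables (c : T -> I) (x : T).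
Hypothesis c_opt : forall j, #|nbrs c x (c x)| <= #|nbrs c x j|.
Hypothesis efree : forall t : seq T, pairwise e t -> size t <= #|I|.

(** Otherwise the neighbourhood of [x] would contain a clique with one vertex of each colour, and
    [x] would extend it beyond the allowed size. *)
Lemma opt_transversal W :
  (forall i, 0 < #|nbrs c x i :\: W|) ->
  ~ (forall i j, i != j -> lack c W < 2 * (#|nbrs c x i :\: W| * #|nbrs c x j :\: W|)).
Proof.
move=> W0 Wlack.
apply: (@transversal_free_lack c W (fun i => nbrs c x i :\: W) (enum I) [:: x] #|I|) => //.
- exact: enum_uniq.
- by rewrite -cardE /= add1n.
- by move=> i _; apply: setSD; apply/subsetP => y; rewrite !inE => /andP[].
- by move=> i _; rewrite -card_gt0.
- by move=> i _ u y; rewrite inE => /eqP ->; rewrite !inE => /and3P[].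
by move=> i j _ _; exact: Wlack.
Qed.

(* The product of the two smallest colour classes in the neighbourhood of [x] is at
   most the number of lacking pairs, and the own class of [x] is the smallest one. *)
Lemma opt_poor_class : 1 < #|I| ->
  exists2 j, j != c x & 2 * (#|nbrs c x (c x)| * #|nbrs c x j|) <= lack c set0.
Proof.
move=> I1; apply/exists_inP; apply: contraT; rewrite negb_exists_in => /forall_inP rich.
have /card_gt0P[j0 jx0] : 0 < #|[set~ c x]| by rewrite cardsC1; lia.
exfalso; apply: (@opt_transversal set0) => [i|i j ij]; rewrite !setD0.
  apply: leq_trans (c_opt i).
  have := rich j0; rewrite !inE in jx0; move=> /(_ jx0).
  by rewrite -ltnNge; case: #|nbrs c x (c x)|.
(* One of two distinct colours differs from that of [x]; its product with the own class is large,
   and the other class is at least as large as the own one. *)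
wlog jx : i j ij / j != c x.
  move=> H; have [jx|jx] := eqVneq j (c x); last exact: H.
  by rewrite [X in 2 * X]mulnC; apply: H; rewrite -?jx // eq_sym.
have := rich j jx; rewrite -ltnNge => /leq_trans; apply.
by rewrite leq_mul2l leq_mul2r c_opt orbT.
Qed.

(** By optimality every colour keeps at least [#|nbrs c x (c x)| - #|W|] neighbours of [x] outside
    [W]. The truncated subtraction makes the bound trivial when [W] is larger. *)
Lemma opt_lack_bound W : 2 * (#|nbrs c x (c x)| - #|W|) ^ 2 <= lack c W.
Proof.
rewrite leqNgt; apply/negP => small.
have big i : #|nbrs c x (c x)| - #|W| <= #|nbrs c x i :\: W|.
  by have := c_opt i; have := cardsD (nbrs c x i) W; have := subset_leq_card (subsetIr (nbrs c x i) W); lia.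
apply: (@opt_transversal W) => [i|i j _].
  by apply: leq_trans (big i); case: (#|_| - _) small.
by apply: leq_trans small _; rewrite leq_mul2l -mulnn leq_mul.
Qed.

End LocalOptimum.
End Coloring.

(** * Eigenvalues of clique-free graphs *)

(** Expand a masked variance, which equals [E * (E * Z - S ^+ 2)]; if [E] vanishes, so does the
    mask. *)
Lemma cauchy_schwarz_mask (R : realFieldType) (J : finType) (a : J -> bool) (z : J -> R) :
  (\sum_p (a p)%:R * z p) ^+ 2 <= (\sum_p (a p)%:R) * \sum_p (a p)%:R * z p ^+ 2.
Proof.
set S := \sum_p _ * z p; set E := \sum_p (a p)%:R; set Z := \sum_p _ * _ ^+ 2.
have E0 : 0 <= E by apply: sumr_ge0.
have : 0 <= \sum_p (a p)%:R * (E * z p - S) ^+ 2.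
  by apply: sumr_ge0 => p _; rewrite mulr_ge0 // sqr_ge0.
have -> : \sum_p (a p)%:R * (E * z p - S) ^+ 2 = E * (E * Z - S ^+ 2).
  rewrite [LHS](eq_bigr (fun p => E ^+ 2 * ((a p)%:R * z p ^+ 2) -
    2 * E * S * ((a p)%:R * z p) + S ^+ 2 * (a p)%:R)); last by move=> p _; ring.
  by rewrite !big_split /= sumrN -!mulr_sumr -/S -/E -/Z; ring.
move: E0; rewrite le_eqVlt => /predU1P[E0 _|E0]; last by rewrite pmulr_rge0 // subr_ge0.
rewrite -E0 mul0r /S big1 ?expr0n //= => p _.
move/esym/eqP: E0; rewrite psumr_eq0 // => /allP/(_ p (mem_index_enum p)).
by move=> /eqP ->; rewrite mul0r.
Qed.

Lemma motzkin_straus (R : realFieldType) (T : finType) (e : rel T) (w : T -> R) (r : nat) :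
  (0 < r)%N -> symmetric e -> (forall x, 0 <= w x) ->
  (forall s : seq T, pairwise e s -> (size s <= r)%N) ->
  \sum_x \sum_y w x * w y * (e x y)%:R <= (1 - r%:R^-1) * (\sum_x w x) ^+ 2.
Proof.
move=> r0 se w0 efree; have [c] := furedi_coloring r0 se w0 efree.
apply: le_trans; rewrite lerDl; apply: sumr_ge0 => x _; apply: sumr_ge0 => y _.
by rewrite !mulr_ge0.
Qed.

(* Nikiforov: for an eigenvector [v], apply Cauchy-Schwarz to the form
   [sum e_ij v_i v_j] and then Motzkin-Straus with the weights [v_i ^+ 2]. *)
Lemma eigenvalue_clique_free (R : realFieldType) (n : nat) (e : rel 'I_n) (r : nat) (mu : R) :
  (0 < r)%N -> symmetric e ->
  (forall s : seq 'I_n, pairwise e s -> (size s <= r)%N) ->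
  eigenvalue (\matrix_(i, j) (e i j)%:R) mu ->
  mu ^+ 2 <= (1 - r%:R^-1) * \sum_i \sum_j (e i j)%:R.
Proof.
move=> r0 se efree /eigenvalueP[v /rowP vmu v0].
pose q := \sum_j v 0 j ^+ 2.
have q0 : 0 < q.
  rewrite lt_def sumr_ge0 ?andbT => [|j _]; last exact: sqr_ge0.
  apply: contra_neq v0; move/eqP; rewrite psumr_eq0 => [/allP vz|j _]; last exact: sqr_ge0.
  apply/rowP => j; rewrite mxE.
  by have := vz j (mem_index_enum j); rewrite sqrf_eq0 => /eqP.
(* The quadratic form becomes a single masked sum over ordered pairs, ready for Cauchy-Schwarz. *)
have muq : mu * q = \sum_(p : 'I_n * 'I_n) (e p.1 p.2)%:R * (v 0 p.1 * v 0 p.2).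
  rewrite -(pair_bigA _ (fun i j => (e i j)%:R * (v 0 i * v 0 j))) exchange_big mulr_sumr.
  apply: eq_bigr => j _; have := vmu j; rewrite !mxE => vj.
  transitivity (mu * v 0 j * v 0 j); first by ring.
  rewrite -vj mulr_suml; apply: eq_bigr => i _; rewrite mxE /=; ring.
have E : \sum_(p : 'I_n * 'I_n) (e p.1 p.2)%:R = \sum_i \sum_j (e i j)%:R :> R.
  by rewrite pair_bigA.
have MS := motzkin_straus r0 se (fun j => sqr_ge0 (v 0 j)) efree.
have := cauchy_schwarz_mask (fun p : 'I_n * 'I_n => e p.1 p.2) (fun p => v 0 p.1 * v 0 p.2).
rewrite -muq E.
have -> : \sum_(p : 'I_n * 'I_n) (e p.1 p.2)%:R * (v 0 p.1 * v 0 p.2) ^+ 2 =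
    \sum_i \sum_j v 0 i ^+ 2 * v 0 j ^+ 2 * (e i j)%:R.
  by rewrite pair_bigA; apply: eq_bigr => p _; ring.
set X := \sum_i \sum_j (e i j)%:R.
have X0 : 0 <= X by apply: sumr_ge0 => i _; apply: sumr_ge0.
move=> CS; rewrite -(@ler_pM2r _ (q ^+ 2)) ?exprn_gt0 // -exprMn.
apply: le_trans (le_trans CS (ler_wpM2l X0 MS)) _; rewrite -/q.
by apply: eq_ler; ring.
Qed.

(** * Stability *)

(* The optimum of [m * d] under the constraint [d ^+ 2 + m / rho <= q ^+ 4] is at
   [d = q ^+ 2 / sqrt 3]; all other terms are of lower order. *)
Lemma inner_optimization (R : rcfType) (q rho m d D : R) :
  0 <= q -> q <= 1 -> 1 <= rho -> 0 <= m -> m <= 16 * rho * q ^+ 4 ->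
  0 <= d -> d <= 2 * q ^+ 2 -> D <= 2 * (m * d) + 32 * rho * q ^+ 7 ->
  2 * d ^+ 2 - 4 * (d * m) + 2 * (m / rho) - 8 * q * m <= 2 * q ^+ 4 + D + m ^+ 2 ->
  D <= 2 * ((2 * rho / (3 * Num.sqrt 3) + (608 * rho ^+ 3 + 16 * rho) * q) * q ^+ 6).
Proof.
move=> q0 q1 rho1 m0 mle d0 dle Dle main.
have rho0 : 0 < rho by lra.
have md : m * d <= 32 * rho * q ^+ 6.
  by apply: le_trans (ler_pM m0 d0 mle dle) _; apply: eq_ler; ring.
have qk (k l : nat) : (l <= k)%N -> q ^+ k <= q ^+ l.
  by move=> lk; apply: ler_wiXn2l.
have rr k : 0 <= rho ^+ k by rewrite exprn_ge0 // ltW.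
have q76 : rho * q ^+ 7 <= rho * q ^+ 6 by rewrite ler_pM2l ?qk.
have q65 : rho * q ^+ 6 <= rho * q ^+ 5 by rewrite ler_pM2l ?qk.
have D1 : D <= 96 * (rho * q ^+ 5) by lra.
have m2 : m ^+ 2 <= 256 * (rho ^+ 2 * q ^+ 5).
  apply: (@le_trans _ _ (256 * (rho ^+ 2 * q ^+ 8))).
    apply: le_trans (ler_pM m0 m0 mle mle) _.
    by apply: eq_ler; ring.
  by rewrite ler_pM2l // ler_wpM2l ?qk.
have qm : q * m <= 16 * (rho * q ^+ 5).
  apply: le_trans (ler_wpM2l q0 mle) _.
  by apply: eq_ler; ring.
have r2 : rho * q ^+ 5 <= rho ^+ 2 * q ^+ 5.
  by rewrite ler_wpM2r ?exprn_ge0 // expr2 ler_peMl // ltW.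
(* The constant 304 is half of 96 + 256 + 128 + 128, which come from [D], [m ^+ 2], [4 * (d * m)]
   and [8 * q * m]. *)
have E : m / rho <= q ^+ 4 + 304 * (rho ^+ 2 * q ^+ 5) - d ^+ 2 by lra.
have mE : m * d <= rho * (q ^+ 4 * d - d ^+ 3) + 304 * (rho ^+ 3 * q ^+ 5) * d.
  have := ler_wpM2r d0 (ler_wpM2l (ltW rho0) E).
  rewrite mulrCA divff ?gt_eqF // mulr1 => /le_trans; apply.
  by apply: eq_ler; ring.
have dq : (rho ^+ 3 * q ^+ 5) * d <= 2 * (rho ^+ 3 * q ^+ 7).
  apply: le_trans (ler_wpM2l _ dle) _; first by rewrite mulr_ge0 ?rr ?exprn_ge0.
  by apply: eq_ler; ring.
have s3 : 0 < Num.sqrt 3 :> R by rewrite sqrtr_gt0.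
have s33 : Num.sqrt 3 ^+ 2 = 3 :> R by rewrite sqr_sqrtr.
have opt : q ^+ 4 * d - d ^+ 3 <= 2 / (3 * Num.sqrt 3) * q ^+ 6.
  pose tau := q ^+ 2 / Num.sqrt 3.
  have t0 : 0 <= tau by rewrite divr_ge0 ?exprn_ge0 // ltW.
  have t2 : q ^+ 4 = 3 * tau ^+ 2.
    by rewrite -s33 /tau; field; rewrite gt_eqF.
  have t3 : 2 / (3 * Num.sqrt 3) * q ^+ 6 = 2 * tau ^+ 3.
    by rewrite -[X in X * Num.sqrt 3]s33 /tau; field; rewrite gt_eqF.
  rewrite t2 t3 -subr_ge0.
  (* The maximiser [tau] is a double root of the difference, so a factorization replaces
     calculus. *)
  have -> : 2 * tau ^+ 3 - (3 * tau ^+ 2 * d - d ^+ 3) = (d - tau) ^+ 2 * (d + 2 * tau) by ring.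
  by rewrite mulr_ge0 ?sqr_ge0 // addr_ge0 // mulr_ge0.
have ropt := ler_wpM2l (ltW rho0) opt.
have -> : 2 * ((2 * rho / (3 * Num.sqrt 3) + (608 * rho ^+ 3 + 16 * rho) * q) * q ^+ 6) =
  2 * (rho * (2 / (3 * Num.sqrt 3) * q ^+ 6)) + 1216 * (rho ^+ 3 * q ^+ 7) + 32 * rho * q ^+ 7.
  by field; rewrite gt_eqF.
lra.
Qed.

Lemma sum_card_class (T I : finType) (c : T -> I) : (\sum_i #|color_class c i|)%N = #|T|.
Proof.
rewrite -sum1_card (partition_big c xpredT) //=; apply: eq_bigr => i _.
by rewrite -sum1_card; apply: eq_bigl => x; rewrite inE.
Qed.

Lemma sum_le_card (R : realFieldType) (T : finType) (A : {set T}) (F : T -> nat) (b : R) :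
  (forall x, x \in A -> (F x)%:R <= b) -> (\sum_(x in A) F x)%N%:R <= #|A|%:R * b.
Proof.
move=> Fb; rewrite natr_sum mulr_natl -sumr_const; exact: ler_sum.
Qed.

(** In the application [q] is the fourth root of [delta], so that the main term is of order [q ^+ 6]
    and all errors are polynomial in [q]. *)
Lemma near_extremal_coloring (R : rcfType) (T : finType) (e : rel T) (r : nat) (q : R) :
  symmetric e -> irreflexive e -> (2 <= r)%N ->
  (forall s : seq T, pairwise e s -> (size s <= r)%N) ->
  (0 < #|T|)%N -> 0 <= q -> 50 * r%:R ^+ 3 * q <= 1 ->
  (1 - r%:R^-1 - 2 * q ^+ 4) * #|T|%:R ^+ 2 <= \sum_x \sum_y (e x y)%:R ->
  exists c : {ffun T -> 'I_r},
    (inner e c)%:R <= 2 * ((2 * r%:R / (3 * Num.sqrt 3) +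
      (608 * r%:R ^+ 3 + 16 * r%:R) * q) * q ^+ 6) * #|T|%:R ^+ 2.
Proof.
move=> se irr r2 efree T0 q0 qr Ebig.
have r0 : (0 < r)%N by lia.
pose N : R := #|T|%:R; have N0 : 0 < N by rewrite ltr0n.
pose rho : R := r%:R; have rho2 : 2 <= rho by rewrite ler_nat.
have rho0 : 0 < rho by lra.
rewrite -/N -/rho in Ebig qr *.
have rho1 : 1 <= rho by lra.
have q1 : 400 * q <= 1.
  apply: le_trans qr; rewrite ler_wpM2r //.
  have : 2 ^+ 3 <= rho ^+ 3 by rewrite lerXn2r ?nnegrE //; lra.
  lra.
have qrho : 200 * (rho * q) <= 1.
  apply: le_trans qr; rewrite mulrA ler_wpM2r //.
  have : rho * 2 ^+ 2 <= rho * rho ^+ 2.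
    by rewrite ler_pM2l // lerXn2r ?nnegrE //; lra.
  by rewrite -exprS; lra.
have [c0 c0P] := furedi_coloring r0 se (fun=> ler01 : 0 <= 1 :> R) efree.
(* The colouring [c0] only supplies an upper bound; the argument runs on a global minimiser [c],
   which is optimal at every vertex. *)
case: (@arg_minnP {ffun T -> 'I_r} (finfun c0) xpredT (inner e)) => // c _ cmin'.
have cmin (c' : {ffun T -> 'I_r}) : (inner e c <= inner e c')%N by exact: cmin'.
exists c; pose D : R := (inner e c)%:R; rewrite -/D.
pose E : R := \sum_x \sum_y (e x y)%:R; rewrite -/E in Ebig.
pose M : R := (lack e c set0)%:R.
have natsum2 (F : T -> T -> nat) : (\sum_x \sum_y F x y)%N%:R = \sum_x \sum_y (F x y)%:R :> R.
  by rewrite natr_sum; apply: eq_bigr => x _; rewrite natr_sum.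
have D0 : D <= 2 * q ^+ 4 * N ^+ 2.
  have Dc0 : D <= (inner e (finfun c0))%:R by rewrite ler_nat.
  move: c0P; rewrite sumr_const -/N.
  have -> : \sum_x \sum_y 1 * 1 * (e x y)%:R = E.
    by apply: eq_bigr => x _; apply: eq_bigr => y _; rewrite !mul1r.
  have -> : \sum_x \sum_y 1 * 1 * (e x y && (c0 x == c0 y))%:R = (inner e (finfun c0))%:R :> R.
    by rewrite natsum2; apply: eq_bigr => x _; apply: eq_bigr => y _; rewrite !mul1r !ffunE.
  lra.
have edges_eq : E + M + \sum_i #|color_class c i|%:R ^+ 2 = N ^+ 2 + D.
  have := congr1 (fun k : nat => k%:R : R) (lack_edges e c).
  rewrite /= !natrD natsum2 -/M -/D -/E natrX -/N natr_sum => <-.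
  by congr (_ + _); apply: eq_bigr => i _; rewrite -natrX.
have dev : \sum_(i < r) (#|color_class c i|%:R - N / rho) ^+ 2 = \sum_i #|color_class c i|%:R ^+ 2 - N ^+ 2 / rho.
  have := sum_sqr_dev (fun i : 'I_r => #|color_class c i|%:R : R) r0.
  by rewrite -natr_sum sum_card_class.
have dev0 : 0 <= \sum_(i < r) (#|color_class c i|%:R - N / rho) ^+ 2.
  by apply: sumr_ge0 => i _; exact: sqr_ge0.
have Ebig' : N ^+ 2 - N ^+ 2 / rho - 2 * q ^+ 4 * N ^+ 2 <= E.
  apply: le_trans Ebig; apply: eq_ler.
  by rewrite /rho; ring.
have M0 : 0 <= M by rewrite ler0n.
(* Lacking pairs and imbalance of the classes share one budget. *)
have MD : M + \sum_(i < r) (#|color_class c i|%:R - N / rho) ^+ 2 <= 2 * q ^+ 4 * N ^+ 2 + D.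
  by rewrite dev; move: edges_eq Ebig'; set Z := N ^+ 2 / rho; lra.
have M4 : M <= 4 * q ^+ 4 * N ^+ 2 by lra.
have class_big i : N / rho - 2 * q ^+ 2 * N <= #|color_class c i|%:R.
  have : (#|color_class c i|%:R - N / rho) ^+ 2 <= (2 * q ^+ 2 * N) ^+ 2.
    have : (#|color_class c i|%:R - N / rho) ^+ 2 <= \sum_(i < r) (#|color_class c i|%:R - N / rho) ^+ 2.
      rewrite [X in _ <= X](bigD1 i) //= lerDl; apply: sumr_ge0 => j _; exact: sqr_ge0.
    have -> : (2 * q ^+ 2 * N) ^+ 2 = 4 * q ^+ 4 * N ^+ 2 by ring.
    lra.
  have Y0 : 0 <= 2 * q ^+ 2 * N by rewrite !mulr_ge0 ?exprn_ge0 // ltW.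
  rewrite -real_normK ?num_real // ler_pXn2r ?nnegrE // ler_norml; lra.
have opt x := fun j => inner_min_nbrs se irr x j cmin.
have efree' s : pairwise e s -> (size s <= #|'I_r|)%N by rewrite card_ord; exact: efree.
pose d x := #|nbrs e c x (c x)|.
(* [S] collects the vertices lacking at least [N / (4 * rho)] pairs, a quarter of an average
   class. *)
have [S SP] : exists S : {set T}, forall x, (x \in S) = (N <= 4 * rho * (lack_deg e c x)%:R).
  by exists [set x | N <= 4 * rho * (lack_deg e c x)%:R] => x; rewrite inE.
have S_small : #|S|%:R <= 16 * rho * q ^+ 4 * N.
  have : #|S|%:R * N <= 4 * rho * M.
    rewrite /M lack_total natr_sum mulr_sumr mulr_natl -sumr_const.
    rewrite [X in _ <= X](bigID [in S]) /=.
    apply: ler_wpDr; first by apply: sumr_ge0 => x _; rewrite !mulr_ge0 // ltW.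
    by apply: ler_sum => x; rewrite SP.
  move=> h; rewrite -(ler_pM2r N0); apply: le_trans h _.
  apply: le_trans (ler_wpM2l _ M4) _; first by lra.
  by apply: eq_ler; ring.
(* The classes in the common neighbourhood of two vertices outside [S] are so large
   that they contain a [K_(r-1)], which an edge would complete to a [K_(r+1)]. *)
have cover x y : e x y -> c x = c y -> (x \in S) || (y \in S).
  move=> exy cxy; apply: contraT; rewrite negb_or !SP -!ltNge => /andP[xS yS]; exfalso.
  have common i : i != c x -> N / (4 * rho) <= #|nbrs e c x i :&: nbrs e c y i|%:R.
    move=> ix; have iy : i != c y by rewrite -cxy.
    have := class_le_common e ix iy; rewrite -(ler_nat R) !natrD.
    have := class_big i.
    have lx : (lack_deg e c x)%:R < N / (4 * rho) by rewrite ltr_pdivlMr ?mulr_gt0 // mulrC.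
    have ly : (lack_deg e c y)%:R < N / (4 * rho) by rewrite ltr_pdivlMr ?mulr_gt0 // mulrC.
    have NE : N / rho = 4 * (N / (4 * rho)) by field; rewrite gt_eqF.
    have : 2 * q ^+ 2 * N <= N / (4 * rho).
      rewrite ler_pdivlMr ?mulr_gt0 //.
      have -> : 2 * q ^+ 2 * N * (4 * rho) = (8 * (rho * q) * q) * N by ring.
      rewrite -[X in _ <= X]mul1r ler_wpM2r ?(ltW N0) //.
      have := ler_wpM2r q0 qrho; lra.
    by rewrite NE; set Z := N / (4 * rho) in lx ly *; lra.
  have Z0 : 0 < N / (4 * rho) by rewrite divr_gt0 ?mulr_gt0.
  apply: (@transversal_free_lack T _ e se c set0 (fun i => nbrs e c x i :&: nbrs e c y i)
    [seq i <- enum 'I_r | i != c x] [:: x; y] r) => //.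
  - by rewrite /= exy.
  - exact: filter_uniq (enum_uniq _).
  - have := count_predC (pred1 (c x)) (enum 'I_r).
    rewrite size_enum_ord count_uniq_mem ?enum_uniq // mem_enum /= add1n size_filter => cnt.
    by rewrite add2n ltnS -[X in (X <= _)%N]cnt.
  - by move=> i _; rewrite setD0; apply/subsetP => z; rewrite !inE => /andP[/andP[]].
  - move=> i; rewrite mem_filter => /andP[/common h _]; rewrite -card_gt0 -(ltr0n R).
    exact: lt_le_trans h.
  - move=> i _ u z; rewrite !inE => /orP[] /eqP -> /andP[/andP[exz _] /andP[eyz _]] //.
  move=> i j; rewrite !mem_filter => /andP[/common hi _] /andP[/common hj _] _.
  rewrite -(ltr_nat R) natrM natrM -/M.
  have := ler_pM (ltW Z0) (ltW Z0) hi hj; set X := _%:R * _%:R => hX.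
  apply: le_lt_trans M4 _; apply: lt_le_trans (ler_wpM2l (ler0n _ 2) hX).
  (* The lack is compared with the product of two common neighbourhoods; their ratio is controlled
     by the small number [8 * rho * q ^+ 2]. *)
  have -> : 4 * q ^+ 4 * N ^+ 2 = (8 * (rho * q) * q) ^+ 2 * (N / (4 * rho) * (N / (4 * rho))).
    by field; rewrite gt_eqF.
  rewrite ltr_pM2r ?(mulr_gt0 Z0 Z0) //.
  have h1 : 8 * (rho * q) * q <= 1 by have := ler_wpM2r q0 qrho; lra.
  have h0 : 0 <= 8 * (rho * q) * q by rewrite !mulr_ge0 // ltW.
  by apply: (@le_lt_trans _ _ (1 ^+ 2)); [rewrite lerXn2r ?nnegrE | rewrite expr1n; lra].
have Dd : D <= 2 * (\sum_(x in S) d x)%N%:R.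
  by have := inner_cover se cover; rewrite -(ler_nat R) natrM.
(* For [q = 0] the bound [D0] already gives the claim; later steps divide by [q ^+ 3 * N]. *)
have [q00|qpos] : q = 0 \/ 0 < q by move: q0; rewrite le_eqVlt => /predU1P[<-|]; [left|right].
  by move: D0; rewrite q00 !expr0n /= !(mulr0, mul0r).
(* The threshold [q ^+ 3 * N] lies strictly between [q ^+ 4 * N] and [q ^+ 2 * N]: vertices
   below it contribute [O(q ^+ 7)] to [D], and those above it have an almost empty
   neighbourhood in some class. *)
pose S' := [set x in S | q ^+ 3 * N <= (d x)%:R].
pose m := #|S'|.
have m_small : m%:R <= 16 * rho * q ^+ 4 * N.
  apply: le_trans S_small; rewrite ler_nat subset_leq_card //.
  by apply/subsetP => x; rewrite inE => /andP[].
have light : (\sum_(x in S :\: S') d x)%N%:R <= 16 * rho * q ^+ 7 * N ^+ 2.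
  apply: le_trans (@sum_le_card _ _ _ _ (q ^+ 3 * N) _) _.
    by move=> x; rewrite !inE => /andP[xn xS]; move: xn; rewrite xS -ltNge => /ltW.
  apply: (@le_trans _ _ (16 * rho * q ^+ 4 * N * (q ^+ 3 * N))).
    rewrite ler_wpM2r ?mulr_ge0 ?exprn_ge0 ?(ltW N0) //.
    by apply: le_trans S_small; rewrite ler_nat subset_leq_card // subsetDl.
  by apply: eq_ler; ring.
have S'S : S' \subset S by apply/subsetP => x; rewrite inE => /andP[].
have splitS : (\sum_(x in S) d x = \sum_(x in S') d x + \sum_(x in S :\: S') d x)%N.
  by rewrite (big_setID S') /= (setIidPr S'S).
(* Some other colour has [a] neighbours with [2 * d x * a <= M], so [d x >= q ^+ 3 * N] forces
   [a <= 2 * q * N]. Nearly that whole class is then lacking at [x]. *)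
have heavy_lack x : x \in S' -> N / rho - 4 * q * N <= (lack_deg e c x)%:R.
  rewrite inE => /andP[_ dx].
  have [|j jx jd] := opt_poor_class se (opt x) efree'; first by rewrite card_ord.
  have aj : #|nbrs e c x j|%:R <= 2 * q * N.
    have := jd; rewrite -(ler_nat R) natrM natrM -/M => jd'.
    have q3N : 0 < 2 * (q ^+ 3 * N) by rewrite !mulr_gt0 // exprn_gt0.
    rewrite -(ler_pM2l q3N).
    have := ler_wpM2r (ler0n R #|nbrs e c x j|) dx; rewrite -/(d x) in jd' *.
    have -> : 2 * (q ^+ 3 * N) * (2 * q * N) = 4 * q ^+ 4 * N ^+ 2 by ring.
    move: jd'; set u := (d x)%:R; set v := _%:R; lra.
  have := class_le_lack_nbrs e jx; rewrite -(ler_nat R) natrD.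
  have := class_big j.
  have : q ^+ 2 * N <= q * N by rewrite ler_pM2r // expr2 ler_piMl //; lra.
  by move: aj; set Z := N / rho; lra.
(* Dividing [m] and [dm] by [N], and [D] by [N ^+ 2], turns these conditions into the hypotheses of
   [inner_optimization]. The witness [dm] is the largest own-colour degree in [S'], or 0 if [S'] is
   empty. *)
suff [dm [dm0 dm2 Ddm main]] : exists dm : R, [/\ 0 <= dm, dm <= 2 * q ^+ 2 * N,
    D <= 2 * (m%:R * dm) + 32 * rho * q ^+ 7 * N ^+ 2 &
    2 * dm ^+ 2 - 4 * (dm * m%:R) + 2 * (m%:R * (N / rho)) - 8 * q * m%:R * N
      <= 2 * q ^+ 4 * N ^+ 2 + D + m%:R ^+ 2].
  have Nn0 : N != 0 by rewrite gt_eqF.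
  have N20 : 0 < N ^+ 2 by rewrite exprn_gt0.
  rewrite -ler_pdivrMr //.
  apply: (@inner_optimization R q rho (m%:R / N) (dm / N)) => //; first by lra.
  - by rewrite divr_ge0 // ltW.
  - by rewrite ler_pdivrMr.
  - by rewrite divr_ge0 // ltW.
  - by rewrite ler_pdivrMr.
  - rewrite ler_pdivrMr //; apply: le_trans Ddm _.
    by apply: eq_ler; field.
  rewrite -(ler_pM2r N20).
  have -> : (2 * (dm / N) ^+ 2 - 4 * (dm / N * (m%:R / N)) + 2 * (m%:R / N / rho) -
     8 * q * (m%:R / N)) * N ^+ 2 =
     2 * dm ^+ 2 - 4 * (dm * m%:R) + 2 * (m%:R * (N / rho)) - 8 * q * m%:R * N.
    by field; rewrite Nn0 gt_eqF.
  apply: le_trans main _.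
  by apply: eq_ler; field.
have [S'0|[x0 x0S]] := set_0Vmem S'.
  exists 0; rewrite /m S'0 cards0 !(mulr0, mul0r, addr0, subr0, expr0n) /=; split=> //.
  - by rewrite !mulr_ge0 // ?exprn_ge0 // ltW.
  - rewrite add0r; apply: le_trans Dd _; rewrite splitS S'0 big_set0 add0n -S'0; lra.
  - by rewrite addr_ge0 // ?ler0n // !mulr_ge0 // ?exprn_ge0 // ltW.
have [x1 x1S dmax] := arg_maxnP d x0S.
exists (d x1)%:R; split=> //.
- have [|j jx jd] := opt_poor_class se (opt x1) efree'; first by rewrite card_ord.
  have dd : 2 * (d x1)%:R ^+ 2 <= M.
    rewrite -natrX -natrM ler_nat; apply: leq_trans jd.
    by rewrite leq_mul2l -mulnn leq_mul2l (opt x1) orbT.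
  have h0 : 0 <= 2 * q ^+ 2 * N by rewrite !mulr_ge0 // ?exprn_ge0 // ltW.
  rewrite -(@ler_pXn2r _ 2) ?nnegrE //.
  have -> : (2 * q ^+ 2 * N) ^+ 2 = 4 * q ^+ 4 * N ^+ 2 by ring.
  by lra.
- apply: le_trans Dd _; rewrite splitS natrD.
  have : (\sum_(x in S') d x)%N%:R <= m%:R * (d x1)%:R :> R.
    by apply: sum_le_card => x xS; rewrite ler_nat; exact: dmax.
  move: light; set u := (\sum_(x in S') d x)%N%:R; set v := (\sum_(x in S :\: S') d x)%N%:R.
  rewrite mulrDr => hv hu; apply: lerD; first by rewrite ler_pM2l.
  by have := ler_wpM2l (ler0n R 2) hv; lra.
(* For the last condition, the lacking pairs at [S'] and those forced outside [S'] by the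
   neighbourhood of [x1] are added up and compared with the budget [MD]. *)
have lb := lack_split se c S'.
have ol := opt_lack_bound se (opt x1) efree' S'.
have hl : m%:R * (N / rho - 4 * q * N) <= (\sum_(x in S') lack_deg e c x)%N%:R.
  rewrite natr_sum mulr_natl -sumr_const; apply: ler_sum => x; exact: heavy_lack.
(* Dropping [m ^ 2] keeps the estimate valid when the subtraction truncates, the left side then
   being nonpositive. *)
have dmle : (d x1)%:R ^+ 2 - 2 * ((d x1)%:R * m%:R) <= ((d x1 - m) ^ 2)%N%:R :> R.
  rewrite natrX; have [md|dm] := leqP m (d x1).
    by rewrite natrB //; have := sqr_ge0 (m%:R : R); lra.
  have -> : (d x1 - m = 0)%N by apply/eqP; rewrite subn_eq0 ltnW.
  have : (d x1)%:R * (d x1)%:R <= (d x1)%:R * m%:R :> R by rewrite ler_wpM2l // ler_nat ltnW.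
  have : 0 <= (d x1)%:R * m%:R :> R by rewrite mulr_ge0.
  by rewrite expr0n /= expr2; lra.
move: lb ol; rewrite -/m -/(d x1) -!(ler_nat R) !natrD natrX !natrM -/M.
rewrite mulrBr in hl.
move: hl dmle; set A1 := (_ ^ 2)%N%:R; set A2 := (\sum_(x in S') _)%N%:R; set A3 := (lack e c S')%:R.
by set Z := m%:R * (N / rho); lra.
Qed.

From mathcomp Require Import all_classical all_reals all_analysis.
Import Order.TTheory GRing.Theory Num.Theory.
Import numFieldNormedType.Exports.
Local Open Scope classical_set_scope.
Local Open Scope ring_scope.

(** * The spectral theorem *)

(** Irreflexivity makes a pairwise adjacent list duplicate-free, so its first [r.+1] entries would
    form a forbidden clique. *)
Lemma clique_free_pairwise (n r : nat) (e : rel 'I_n) :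
  symmetric e -> irreflexive e -> ~ has_clique r.+1 e ->
  forall s : seq 'I_n, pairwise e s -> (size s <= r)%N.
Proof.
move=> se irr nocl s es; rewrite leqNgt; apply/negP => rs; apply: nocl.
have [x0 _] : exists x0 : 'I_n, true by case: (s) rs => // x0; exists x0.
exists (fun i => nth x0 s i).
have us := pairwise_uniq irr es.
have ltis (i : 'I_r.+1) : (i < size s)%N by apply: leq_trans (ltn_ord i) rs.
split=> [i j /eqP|i j ij]; first by rewrite nth_uniq // => /eqP/val_inj.
wlog lij : i j ij / (i < j)%N.
  move=> H; case: (ltngtP i j) => [|h|/val_inj h]; first exact: H.
    by rewrite se; apply: H => //; rewrite eq_sym.
  by rewrite h eqxx in ij.
by move/(pairwiseP x0): es; apply; rewrite ?inE.
Qed.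

(** Deleting the monochromatic edges makes [c] proper, and [inner] counts each of them in both
    orders. *)
Lemma Dr_le_inner (n r : nat) (e : rel 'I_n) (c : {ffun 'I_n -> 'I_r}) :
  symmetric e -> (2 * Dr r e <= inner e c)%N.
Proof.
move=> se; pose F := [set p in edges e | c p.1 == c p.2].
have FE : (Dr r e <= #|F|)%N.
  apply: (@bigmin_le_cond _ nat _ _ F); apply/andP; split.
    by apply/fintype.subsetP => p; rewrite inE => /andP[].
  apply/existsP; exists c; apply/forall_inP => p pe; apply/implyP.
  by rewrite inE pe.
apply: leq_trans (_ : 2 * #|F| <= _)%N; first by rewrite leq_mul2l.
pose k (p : 'I_n * 'I_n) : bool := e p.1 p.2 && (c p.1 == c p.2).
have -> : inner e c = (\sum_p k p)%N by rewrite /inner (pair_bigA _ (fun x y => (e x y && (c x == c y)) : nat)). 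
pose sw (p : 'I_n * 'I_n) := (p.2, p.1).
have swK : involutive sw by move=> [].
have Fk : (#|F| = \sum_p (k p && (p.1 < p.2)))%N.
  rewrite sum_bool_card; apply: eq_card => p; rewrite !inE /k.
  by case: (_ < _)%N; case: (e _ _); case: (_ == _).
rewrite mul2n -addnn {1}Fk Fk [X in (_ + X)%N](reindex_inj (inv_inj swK)) -big_split.
apply: leq_sum => p _; rewrite /k /= se [c p.2 == _]eq_sym.
by case: (e _ _); case: (_ == _) => //=; case: ssrnat.ltngtP.
Qed.

Lemma spec_rad_clique_free (R : realType) (n : nat) (e : rel 'I_n) (r : nat) :
  (0 < r)%N -> symmetric e ->
  (forall s : seq 'I_n, pairwise e s -> (size s <= r)%N) ->
  spec_rad R e <= Num.sqrt ((1 - r%:R^-1) * \sum_i \sum_j (e i j)%:R).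
Proof.
move=> r0 se efree; rewrite /spec_rad.
set A := [set mu : R | _].
(* The supremum of the empty set is 0 by convention. *)
have [->|A0] := eqVneq A set0; first by rewrite sup0 sqrtr_ge0.
apply: ge_sup; first exact/set0P.
move=> mu /= /(eigenvalue_clique_free r0 se efree) h.
by apply: le_trans (ler_norm mu) _; rewrite -sqrtr_sqr ler_wsqrtr.
Qed.

(** With [s] for [1 - 1/r], the spectral bound squares to [(s - delta) ^+ 2 * n ^+ 2 <= s * E], and
    [(s - delta) ^+ 2 >= s * (s - 2 * delta)]. The bound on [delta] keeps [s - delta] nonnegative,
    which squaring requires. *)
Lemma many_edges (R : realType) (n : nat) (e : rel 'I_n) (r : nat) (delta : R) :
  (2 <= r)%N -> symmetric e ->
  (forall s : seq 'I_n, pairwise e s -> (size s <= r)%N) ->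
  delta <= 1 / 2 ->
  (1 - r%:R^-1 - delta) * n%:R <= spec_rad R e ->
  (1 - r%:R^-1 - 2 * delta) * n%:R ^+ 2 <= \sum_i \sum_j (e i j)%:R.
Proof.
move=> r2 se efree d2 hspec.
have r0 : (0 < r)%N by lia.
pose E : R := \sum_i \sum_j (e i j)%:R.
have E0 : 0 <= E by apply: sumr_ge0 => i _; apply: sumr_ge0.
have rinv : r%:R^-1 <= 1 / 2 :> R.
  by rewrite div1r lef_pV2 ?posrE ?ltr0n // ler_nat.
have := le_trans hspec (spec_rad_clique_free R r0 se efree); rewrite -/E.
set s : R := 1 - r%:R^-1 in rinv *; have s0 : 0 < s by rewrite /s; lra.
have sd0 : 0 <= s - delta by rewrite /s; lra.
rewrite -(@ler_pXn2r _ 2) ?nnegrE ?sqrtr_ge0 ?mulr_ge0 //.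
rewrite sqr_sqrtr ?mulr_ge0 // ?(ltW s0) // => h.
rewrite -/E -(ler_pM2l s0); apply: le_trans h.
have -> : ((s - delta) * n%:R) ^+ 2 = s * ((s - 2 * delta) * n%:R ^+ 2) + (delta * n%:R) ^+ 2 by ring.
by rewrite lerDl sqr_ge0.
Qed.

Theorem theorem3p5 (R : realType) (r : nat) (hr : (2 <= r)%N) :
  exists f : R -> R,
    (f x @[x --> 0^'+] --> 0) /\
    forall (n : nat) (delta : R) (e : rel 'I_n),
      (3 * r ^ 2 <= n)%N ->
      0 <= delta -> delta <= (10 ^+ 7 * r%:R ^+ 12)^-1 ->
      simple_graph e ->
      ~ has_clique r.+1 e ->
      spec_rad R e >= (1 - r%:R^-1 - delta) * n%:R ->
      (Dr r e)%:R <=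
        (2 * r%:R / (3 * Num.sqrt 3) + f delta) * powR delta (3 / 2) * n%:R ^+ 2.
Proof.
(* The error term is [K] times the fourth root of [delta], with [K] taken from
   [near_extremal_coloring]. *)
pose K : R := 608 * r%:R ^+ 3 + 16 * r%:R.
exists (fun x => K * Num.sqrt (Num.sqrt x)); split.
  apply: cvg_at_right_filter.
  suff : K * Num.sqrt (Num.sqrt x) @[x --> 0] --> K * Num.sqrt (Num.sqrt 0).
    by rewrite !sqrtr0 mulr0.
  by apply: cvgMl_tmp; apply: continuous_comp; exact: sqrt_continuous.
move=> n delta e rn d0 dle [se irr] nocl hspec.
have efree := clique_free_pairwise se irr nocl.
pose q := Num.sqrt (Num.sqrt delta).
have q0 : 0 <= q by exact: sqrtr_ge0.
have q2 : q ^+ 2 = Num.sqrt delta by rewrite sqr_sqrtr // sqrtr_ge0.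
have q4 : q ^+ 4 = delta by rewrite (exprM q 2 2) q2 sqr_sqrtr.
have q6 : powR delta (3 / 2) = q ^+ 6.
  rewrite mulrC powRrM powR12_sqrt // -q2 powR_mulrn ?exprn_ge0 //.
  by rewrite -exprM.
have rho2 : 2 <= r%:R :> R by rewrite ler_nat.
have rho0 : 0 < r%:R :> R by lra.
have qr4 : 10 ^+ 7 * (r%:R ^+ 3 * q) ^+ 4 <= 1.
  rewrite exprMn q4 -exprM mulrA.
  have p0 : 0 < 10 ^+ 7 * r%:R ^+ (3 * 4) :> R by rewrite mulr_gt0 // exprn_gt0.
  have := ler_wpM2l (ltW p0) dle; rewrite divff ?gt_eqF //.
(* Fourth powers are compared: [50 ^+ 4] is 6250000, below [10 ^+ 7]. *)
have qr : 50 * r%:R ^+ 3 * q <= 1.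
  rewrite -mulrA -(@ler_pXn2r _ 4) ?nnegrE ?ler01 //; last first.
    by rewrite !mulr_ge0 // exprn_ge0 // ltW.
  rewrite expr1n exprMn; apply: le_trans qr4.
  by rewrite ler_wpM2r ?exprn_ge0 ?mulr_ge0 ?exprn_ge0 ?(ltW rho0) //; lra.
have d2 : delta <= 1 / 2.
  apply: le_trans dle _; rewrite div1r lef_pV2 ?posrE ?mulr_gt0 ?exprn_gt0 //.
  have : 1 <= r%:R ^+ 12 :> R by rewrite exprn_ege1 //; lra.
  lra.
have Ebig := many_edges hr se efree d2 hspec.
have n0 : (0 < #|'I_n|)%N by rewrite card_ord; apply: leq_trans rn; rewrite muln_gt0 expn_gt0; lia.
have [|c cP] := near_extremal_coloring se irr hr efree n0 q0 qr.
  by rewrite card_ord q4.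
move: cP; rewrite card_ord -/K -q6 => cP.
have := Dr_le_inner c se; rewrite -(ler_nat R) natrM => /le_trans/(_ cP).
by rewrite -!(mulrA 2) ler_pM2l.
Qed.
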